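(* Let $p,Q$ be real-valued measurable functions on the finite interval $\mathcal J=(a,b)$ with $1/p,\ Q/p,\ Q^2/p\in L_1(\mathcal J)$. Let $K$ be a unitary $2\times2$ complex matrix, so that the boundary conditions $$(K-I)\Gamma_1y+i(K+I)\Gamma_2y=0$$ defining the operator $L_K$ (see the context) are self-adjoint. These boundary conditions are separated if and only if $$K=\begin{pmatrix}K_a&0\\0&K_b\end{pmatrix}$$ where $K_a,K_b\in\mathbb C$ and $|K_a|=|K_b|=1$.
   Context: Let $\mathcal J=(a,b)$ be a finite interval and $L_2=L_2(\mathcal J,\mathbb C)$; $p$ is finite and nonzero a.e. The formal expression $-(py')'+qy$ with $q=Q'$ (distributional derivative) is interpreted through the quasi-derivatives $$D^{[0]}y=y,\qquad D^{[1]}y=py'-Qy,\qquad D^{[2]}y=(D^{[1]}y)'+\frac Qp D^{[1]}y+\frac{Q^2}{p}y$$ as $l[y]:=-D^{[2]}y$. The maximal operator is $L_{\max}y=l[y]$ with $\operatorname{Dom}(L_{\max})=\{y\in L_2:\ y,D^{[1]}y\in AC([a,b],\mathbb C),\ D^{[2]}y\in L_2\}$. Define $\Gamma_1,\Gamma_2:\operatorname{Dom}(L_{\max})\to\mathbb C^2$ by $$\Gamma_1y=(D^{[1]}y(a),-D^{[1]}y(b)),\qquad \Gamma_2y=(y(a),y(b)).$$ For a linear operator $K$ on $\mathbb C^2$, $L_K$ denotes the restriction of $L_{\max}$ to the set of $y\in\operatorname{Dom}(L_{\max})$ satisfying $(K-I)\Gamma_1y+i(K+I)\Gamma_2y=0$.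 For a continuous function $f$ on $[a,b]$ and $c\in[a,b]$, $\mathbf{f_c}$ denotes the germ of $f$ at $c$ (within $[a,b]$). The boundary conditions defining an operator $L\subset L_{\max}$ are called separated if for arbitrary $y\in\operatorname{Dom}(L)$ and $g,h\in\operatorname{Dom}(L_{\max})$ with $\mathbf{g_a}=\mathbf{y_a}$, $\mathbf{g_b}=0$, $\mathbf{h_a}=0$, $\mathbf{h_b}=\mathbf{y_b}$ one has $g,h\in\operatorname{Dom}(L)$. *)

(* Defs.v *)
From mathcomp Require Import all_boot all_order all_algebra spectral.
From mathcomp Require Import all_classical all_reals all_analysis.
From mathcomp.real_closed Require Import complex.
Set Implicit Arguments.
Unset Strict Implicit.
Unset Printing Implicit Defensive.
Import Order.TTheory GRing.Theory Num.Theory.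
Import numFieldNormedType.Exports.
Local Open Scope classical_set_scope.
Local Open Scope ring_scope.
Local Open Scope complex_scope.

(* Coefficients and functions on the interval are total functions on R, whose
   values outside [a, b] are never used. *)

Definition ae_on (R : realType) (a b : R) (P : R -> Prop) : Prop :=
  {ae lebesgue_measure, forall x, x \in `]a, b[ -> P x}.

(* [measurable_fun] and [integrable] refer to the Borel sigma-algebra.  A
   function is Lebesgue measurable if and only if it agrees a.e. with a Borel
   one, so the two predicates below are Lebesgue measurability on (a, b) and
   membership in L_1(a, b). *)
Definition lebesgue_measurable_on (R : realType) (a b : R) (f : R -> R) : Prop :=
  exists2 g : R -> R, measurable_fun `]a, b[ g & ae_on a b (fun x => f x = g x).

Definition in_L1 (R : realType) (a b : R) (f : R -> R) : Prop :=
  exists2 g : R -> R,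
    lebesgue_measure.-integrable `]a, b[ (fun x => (g x)%:E) &
    ae_on a b (fun x => f x = g x).

Definition in_L2 (R : realType) (a b : R) (f : R -> R[i]) : Prop :=
  [/\ lebesgue_measurable_on a b (fun x => complex.Re (f x)),
      lebesgue_measurable_on a b (fun x => complex.Im (f x)) &
      in_L1 a b (fun x => complex.Re `|f x| ^+ 2)].

(* AC([a, b], C).  The modulus `|z| is an element of R[i] with zero imaginary
   part, whence the real part. *)
Definition abs_continuous (R : realType) (a b : R) (f : R -> R[i]) : Prop :=
  forall e : R, 0 < e -> exists2 d : R, 0 < d &
  forall (n : nat) (s t : 'I_n -> R),
    (forall k, a <= s k /\ s k < t k /\ t k <= b) ->
    trivIset [set: 'I_n] (fun k => `]s k, t k[%classic) ->
    \sum_(k < n) (t k - s k) < d ->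
    \sum_(k < n) complex.Re `|f (t k) - f (s k)| < e.

(* Junk where the derivative does not exist; it is only applied to absolutely
   continuous functions, for which this is a null set. *)
Definition cderiv (R : realType) (f : R -> R[i]) (x : R) : R[i] :=
  derive1 (fun t => complex.Re (f t)) x +i* derive1 (fun t => complex.Im (f t)) x.

(* An absolutely continuous function equal to f a.e. on (a, b), unique on
   [a, b]; when there is none, f itself, which is then not absolutely
   continuous.  So [abs_continuous (ac_version f)] says exactly that the a.e.
   class of f has an absolutely continuous representative. *)
Definition ac_version (R : realType) (a b : R) (f : R -> R[i]) : R -> R[i] :=
  xget f [set u | abs_continuous a b u /\ ae_on a b (fun x => u x = f x)].

(* D^[1] y = p y' - Q y is defined a.e. only; its values at the end-points are
   those of the absolutely continuous version. *)
Definition qderiv1 (R : realType) (a b : R) (p Q : R -> R) (y : R -> R[i]) :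
    R -> R[i] :=
  ac_version a b (fun x => (p x)%:C * cderiv y x - (Q x)%:C * y x).

Definition qderiv2 (R : realType) (a b : R) (p Q : R -> R) (y : R -> R[i]) :
    R -> R[i] :=
  fun x => cderiv (qderiv1 a b p Q y) x
           + (Q x / p x)%:C * qderiv1 a b p Q y x
           + (Q x ^+ 2 / p x)%:C * y x.

Definition dom_Lmax (R : realType) (a b : R) (p Q : R -> R) : set (R -> R[i]) :=
  [set y | [/\ in_L2 a b y, abs_continuous a b y,
               abs_continuous a b (qderiv1 a b p Q y) &
               in_L2 a b (qderiv2 a b p Q y)]].

Definition Gamma1 (R : realType) (a b : R) (p Q : R -> R) (y : R -> R[i]) :
    'cV[R[i]]_2 :=
  \col_(i < 2) if i == 0 then qderiv1 a b p Q y a else - qderiv1 a b p Q y b.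

Definition Gamma2 (R : realType) (a b : R) (y : R -> R[i]) : 'cV[R[i]]_2 :=
  \col_(i < 2) if i == 0 then y a else y b.

(* L_K is the restriction of L_max to this set. *)
Definition dom_LK (R : realType) (a b : R) (p Q : R -> R) (K : 'M[R[i]]_2) :
    set (R -> R[i]) :=
  [set y | dom_Lmax a b p Q y /\
     (K - 1%:M) *m Gamma1 a b p Q y
     + 'i%C *: ((K + 1%:M) *m Gamma2 a b y) = 0].

(* Equality of the germs at c of f and g, as functions on [a, b]. *)
Definition same_germ (R : realType) (a b c : R) (f g : R -> R[i]) : Prop :=
  \forall x \near within `[a, b] (nbhs c), f x = g x.

(* Separatedness of the boundary conditions defining the restriction of L_max
   with domain D. *)
Definition separated_bc (R : realType) (a b : R) (p Q : R -> R)
    (D : set (R -> R[i])) : Prop :=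
  forall y g h : R -> R[i],
    D y -> dom_Lmax a b p Q g -> dom_Lmax a b p Q h ->
    same_germ a b a g y -> same_germ a b b g (fun=> 0) ->
    same_germ a b a h (fun=> 0) -> same_germ a b b h y ->
    D g /\ D h.

(* Main.v *)
(* The boundary conditions read K (Gamma1 y + i Gamma2 y) = Gamma1 y - i Gamma2 y.
   An absolutely continuous function is determined near an end-point by its
   a.e. values there, so y(c) and D^[1]y(c) depend only on the germ of y at c;
   this makes the conditions separated when K is diagonal.  For the converse,
   choose y in Dom(L_K) with Gamma1 y + i Gamma2 y = (1, 0), in the form g + h
   with g vanishing near b and h near a.  The second row for g says K_21 = 0,
   and unitarity gives the rest.

   Such g and h come from the controllability of the system
     y' = w z + r y,  z' = F - (r z + s y),  w = 1/p, r = Q/p, s = Q^2/p,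
   on an interval (c, d) so short that |w| + |r| + |s| has integral at most 1/4.
   There Picard iteration is a contraction and yields homogeneous solutions
   (e1, z1), (e2, z2) close to (1, 0), (0, 1).  Varying the constants,
   y = k1 e1 + k2 e2 and z = k1 z1 + k2 z2 with k1' = f e2, k2' = - f e1, solves
   the system for the bounded F = f (e2 z1 - e1 z2).  Any transfer of (y, z) is
   achieved by some f = c1 e1 + c2 e2, because the Gram matrix of (e1, e2) is
   invertible: if u = k1 e1 + k2 e2 vanishes on (c, d), then so does w v for
   v = k1 z1 + k2 z2, hence v itself, and (k1, k2) = (u, v)(c) = 0. *)
Require Import Defs.
From mathcomp Require Import all_boot all_order all_algebra spectral.
From mathcomp Require Import all_classical all_reals all_analysis.
From mathcomp.real_closed Require Import complex.
From mathcomp Require Import measurable_realfun ring lra.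
Set Implicit Arguments.
Unset Strict Implicit.
Unset Printing Implicit Defensive.
Import Order.TTheory GRing.Theory Num.Theory.
Import numFieldNormedType.Exports.
Local Open Scope classical_set_scope.
Local Open Scope ring_scope.
Local Open Scope complex_scope.

(** * Primitives of integrable functions and absolute continuity *)

Section Primitive.
Context {R : realType}.
Notation mu := (@lebesgue_measure R).
Implicit Types f g F G : R -> R.

(** Integrability over the whole line: functions on a subinterval are extended by zero, so
    primitives and products need no endpoint bookkeeping. *)
Definition intg f := mu.-integrable setT (EFin \o f).

Definition bounded_by (M : R) f := forall x, `|f x| <= M.

Lemma intg_measurable f : intg f -> measurable_fun setT f.
Proof. by move=> /measurable_int /measurable_EFinP. Qed.

Lemma intgD f g : intg f -> intg g -> intg (fun x => f x + g x).
Proof. by move=> fi gi; apply: (integrableD measurableT fi gi). Qed.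

Lemma intg_norm f : intg f -> intg (fun x => `|f x|).
Proof. by move=> fi; apply: (integrable_norm fi). Qed.

Lemma intgS f (i : interval R) : intg f ->
  mu.-integrable [set` i] (EFin \o f).
Proof. by move=> fi; apply: (integrableS measurableT _ _ fi) => //; exact: measurable_itv. Qed.

Lemma intgM f g M : intg f -> measurable_fun setT g -> bounded_by M g ->
  intg (fun x => f x * g x).
Proof.
move=> fi mg bg; apply: (integrableMl measurableT fi mg).
exists M; split; first exact: num_real.
by move=> x Mx y _ /=; apply: le_trans (bg y) (ltW Mx).
Qed.

(** Starting at minus infinity makes the primitive of a function supported in []c, d[] vanish up to
    [c] and stay constant from [d] on. *)
Definition prim f (x : R) : R := \int[mu]_(t in `]-oo, x]) f t.

Lemma prim_norm_le f g x : intg f -> intg g -> (forall t, `|f t| <= g t) ->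
  `|prim f x| <= \int[mu]_t g t.
Proof.
move=> fi gi fg.
have g0 t : 0 <= g t by apply: le_trans (fg t).
apply: (@le_trans _ _ (\int[mu]_(t in `]-oo, x]) `|f t|)).
  apply: le_normr_Rintegral => //.
  exact: intgS.
apply: (@le_trans _ _ (\int[mu]_(t in `]-oo, x]) g t)).
  apply: le_Rintegral => //.
    exact: intgS (intg_norm fi).
  exact: intgS.
rewrite -lee_fin !fineK.
- apply: ge0_subset_integral => //; first exact: (measurable_int _ gi).
  by move=> t _; rewrite lee_fin.
- exact: integrable_fin_num.
- by apply: integrable_fin_num => //; exact: intgS.
Qed.

Lemma primB f s t : intg f -> s <= t ->
  prim f t - prim f s = \int[mu]_(x in `]s, t]) f x.
Proof.
move=> fi st; rewrite /prim Rintegral_itvB ?bnd_simp //.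
exact: intgS.
Qed.

Definition abs_cont F := forall e : R, 0 < e -> exists2 d : R, 0 < d &
  forall (n : nat) (s t : 'I_n -> R), (forall k, s k < t k) ->
    trivIset [set: 'I_n] (fun k => `]s k, t k[%classic) ->
    \sum_(k < n) (t k - s k) < d ->
    \sum_(k < n) `|F (t k) - F (s k)| < e.

(** The disjoint intervals have a union of small measure, and the integral of [|f|] over a set of
    small measure is small. *)
Lemma abs_cont_prim f : intg f -> abs_cont (prim f).
Proof.
move=> fi e e0.
have [d [d0 Hd]] := integral_normr_continuous fi e0.
exists d => // n s t st tI sd.
pose A := \big[setU/set0]_(k < n) `]s k, t k[%classic.
have mA : measurable A.
  by apply: bigsetU_measurable => k _; exact: measurable_itv.
have muA : (mu A < d%:E)%E.
  apply: le_lt_trans (_ : _ <= (\sum_(k < n) (t k - s k))%:E)%E _; last first.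
    by rewrite lte_fin.
  rewrite /A measure_bigsetU_ord //.
  rewrite -sumEFin; apply: lee_sum => k _.
  by rewrite /= lebesgue_measure_itv /= lte_fin st EFinB.
apply: le_lt_trans (Hd A mA muA).
have iA (B : set (measurableTypeR R)) : measurable B ->
    mu.-integrable B (EFin \o (fun x => `|f x|)).
  by move=> mB; apply: (integrableS measurableT mB _ (intg_norm fi)).
have -> : \int[mu]_(x in A) `|f x| = \sum_(k < n) \int[mu]_(x in `]s k, t k[) `|f x|.
  rewrite /A /Rintegral integral_bigsetU_EFin //=.
  - rewrite -sum_fine //= => k _.
    exact: integrable_fin_num (iA _ (measurable_itv _)).
  - exact: index_enum_uniq.
  - exact: sub_trivIset tI.
  - exact: measurable_int (iA _ mA).
apply: ler_sum => k _.
rewrite (primB fi (ltW (st k))) Rintegral_itv_bndo_bndc; last first.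
  exact: iA (measurable_itv _).
apply: le_normr_Rintegral => //.
exact: intgS.
Qed.

Lemma abs_cont_cont F : abs_cont F -> forall e, 0 < e -> exists2 d, 0 < d &
  forall s t, s < t -> t - s < d -> `|F t - F s| < e.
Proof.
move=> acF e e0; have [d d0 Hd] := acF e e0; exists d => // s t st tsd.
have := Hd 1%N (fun=> s) (fun=> t); rewrite !big_ord1; apply => //.
by move=> i j _ _ _; rewrite !ord1.
Qed.

Lemma abs_cont_continuous F : abs_cont F -> continuous F.
Proof.
move=> acF x; apply/cvgrPdist_lt => e e0.
have [d d0 Hd] := abs_cont_cont acF e0.
near=> y.
have xyd : `|x - y| < d by near: y; apply: cvgr_dist_lt.
have [xy|yx|->] := ltgtP x y.
- by rewrite distrC; apply: Hd => //; rewrite distrC gtr0_norm // subr_gt0 in xyd.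
- by apply: Hd => //; rewrite gtr0_norm // subr_gt0 in xyd.
- by rewrite subrr normr0.
Unshelve. all: by end_near. Qed.

Lemma ae_imply (P Q : R -> Prop) : (forall x, P x -> Q x) ->
  {ae mu, forall x, P x} -> {ae mu, forall x, Q x}.
Proof. exact: (@filterS _ _ (ae_filter_ringOfSetsType mu)). Qed.

Lemma ae_imply2 (P Q S : R -> Prop) : (forall x, P x -> Q x -> S x) ->
  {ae mu, forall x, P x} -> {ae mu, forall x, Q x} -> {ae mu, forall x, S x}.
Proof. exact: (@filterS2 _ _ (ae_filter_ringOfSetsType mu)). Qed.

Lemma prim_derive f : intg f -> {ae mu, forall x : R, is_derive x (1 : R) (prim f) (f x)}.
Proof.
move=> fi.
have locf : locally_integrable setT f.
  by apply: open_integrable_locally => //; exact: openT.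
have := FTC1Ny (fun y => intgS _ fi) locf.
apply: ae_imply => x [dx <-].
by rewrite derive1E; apply: derivableP.
Qed.

(** Boundedness is included because on the whole line a product of absolutely continuous functions
    need not be absolutely continuous without it. *)
Definition ac_deriv F f :=
  [/\ abs_cont F, exists M, bounded_by M F &
      {ae mu, forall x : R, is_derive x (1 : R) F (f x)}].

Lemma ac_deriv_cst (c : R) : ac_deriv (fun=> c) (fun=> 0).
Proof.
split.
- move=> e e0; exists 1 => // n s t _ _ _.
  by rewrite big1 // => k _; rewrite subrr normr0.
- by exists `|c| => x.
- by apply: aeW => x; exact: is_derive_cst.
Qed.

Lemma ac_deriv_prim f : intg f -> ac_deriv (prim f) f.
Proof.
move=> fi; split; [exact: abs_cont_prim| |exact: prim_derive].
exists (\int[mu]_t `|f t|) => x.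
by apply: prim_norm_le => //; exact: intg_norm.
Qed.

Lemma abs_contD F G : abs_cont F -> abs_cont G -> abs_cont (fun x => F x + G x).
Proof.
move=> aF aG e e0; have e2 : 0 < e / 2 by rewrite divr_gt0.
have [d d0 Hd] := aF _ e2; have [d' d'0 Hd'] := aG _ e2.
exists (Num.min d d'); first by rewrite lt_min d0.
move=> n s t st tI; rewrite lt_min => /andP[sd sd'].
apply: (@le_lt_trans _ _ (\sum_(k < n) `|F (t k) - F (s k)| +
                          \sum_(k < n) `|G (t k) - G (s k)|)).
  rewrite -big_split; apply: ler_sum => k _ /=.
  by rewrite opprD addrACA ler_normD.
by rewrite (splitr e) ltrD // ?Hd ?Hd'.
Qed.

Lemma ac_derivD F f G g : ac_deriv F f -> ac_deriv G g ->
  ac_deriv (fun x => F x + G x) (fun x => f x + g x).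
Proof.
move=> [aF [M MF] dF] [aG [N NG] dG]; split; first exact: abs_contD.
- exists (M + N) => x; apply: le_trans (ler_normD _ _) _.
  exact: lerD.
- by apply: ae_imply2 dF dG => x Fx Gx; exact: is_deriveD.
Qed.

Lemma ac_derivM F f G g : ac_deriv F f -> ac_deriv G g ->
  ac_deriv (fun x => F x * G x) (fun x => f x * G x + F x * g x).
Proof.
move=> [aF [M MF] dF] [aG [N NG] dG].
have M0 : 0 <= M by apply: le_trans (MF 0).
have N0 : 0 <= N by apply: le_trans (NG 0).
split.
(* The summand 1 keeps the denominator positive when both bounds are 0; it also leaves the slack
   [N * e1 + M * e1 = e / 2 - e1]. *)
- move=> e e0; pose e1 := e / 2 / (M + N + 1).
  have MN0 : 0 < M + N + 1 by rewrite ltr_wpDl // addr_ge0.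
  have e10 : 0 < e1 by rewrite !divr_gt0.
  have [d d0 Hd] := aF _ e10; have [d' d'0 Hd'] := aG _ e10.
  exists (Num.min d d'); first by rewrite lt_min d0.
  move=> n s t st tI; rewrite lt_min => /andP[sd sd'].
  apply: (@le_lt_trans _ _ (N * \sum_(k < n) `|F (t k) - F (s k)| +
                            M * \sum_(k < n) `|G (t k) - G (s k)|)).
    rewrite !mulr_sumr -big_split; apply: ler_sum => k _ /=.
    have -> : F (t k) * G (t k) - F (s k) * G (s k) =
      G (t k) * (F (t k) - F (s k)) + F (s k) * (G (t k) - G (s k)) by ring.
    apply: le_trans (ler_normD _ _) _; rewrite !normrM.
    by apply: lerD; apply: ler_wpM2r.
  have h1 : N * \sum_(k < n) `|F (t k) - F (s k)| <= N * e1.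
    by apply: ler_wpM2l => //; rewrite ltW // Hd.
  have h2 : M * \sum_(k < n) `|G (t k) - G (s k)| <= M * e1.
    by apply: ler_wpM2l => //; rewrite ltW // Hd'.
  have h3 : (M + N + 1) * e1 = e / 2 by rewrite /e1 mulrCA divff ?mulr1 ?gt_eqF.
  apply: le_lt_trans (lerD h1 h2) _.
  have -> : N * e1 + M * e1 = e / 2 - e1 by rewrite -h3; ring.
  lra.
- exists (M * N) => x; rewrite normrM.
  by apply: ler_pM.
- apply: ae_imply2 dF dG => x Fx Gx.
  have := is_deriveM Fx Gx.
  by rewrite /GRing.scale /= addrC [G x * _]mulrC.
Qed.

End Primitive.

(** * Picard iteration for a first-order system with small L1 coefficients *)

Section Picard.
Context {R : realType}.
Notation mu := (@lebesgue_measure R).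
Implicit Types f g u v : R -> R.

Lemma eq_prim f g x : f =1 g -> prim f x = prim g x.
Proof. by move=> fg; apply: eq_Rintegral => t _; rewrite fg. Qed.

Lemma primB2 f g x : intg f -> intg g ->
  prim f x - prim g x = prim (fun t => f t - g t) x.
Proof.
by move=> fi gi; rewrite /prim RintegralB //; apply: intgS.
Qed.

Lemma measurable_prim f : intg f -> measurable_fun setT (prim f).
Proof.
move=> fi; apply: continuous_measurable_fun.
exact: abs_cont_continuous (abs_cont_prim fi).
Qed.

Lemma le_norm_lim (x_ : nat -> R) (l c M : R) : x_ n @[n --> \oo] --> l ->
  (forall n, `|x_ n - c| <= M) -> `|l - c| <= M.
Proof.
move=> xl xM.
have cn : `|x_ n - c| @[n --> \oo] --> `|l - c|.
  by apply: cvg_norm; apply: cvgB => //; exact: cvg_cst.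
rewrite -(cvg_lim _ cn)//; apply: limr_le; first by apply/cvg_ex; eexists; exact: cn.
by apply: nearW => n; exact: xM.
Qed.

(** Dominated convergence; it carries the integral equations of the Picard iterates over to their
    limit. *)
Lemma prim_cvg (f_ : nat -> R -> R) f g x :
  (forall n, measurable_fun setT (f_ n)) ->
  (forall t, f_ ^~ t @ \oo --> f t) -> intg g ->
  (forall n t, `|f_ n t| <= g t) ->
  prim (f_ n) x @[n --> \oo] --> prim f x.
Proof.
move=> mf cf gi fg.
have mfl : measurable_fun setT f.
  by apply: (@measurable_fun_cvg _ _ _ _ f_) => // t _; exact: cf.
have fgl t : `|f t| <= g t.
  by rewrite -[f t]subr0; apply: le_norm_lim (cf t) _ => n; rewrite subr0.
have fi : intg f.
  apply: le_integrable gi => //; first exact/measurable_EFinP.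
  by move=> t _ /=; rewrite lee_fin (le_trans (fgl t)) ?ler_norm.
have H : (\int[mu]_(t in `]-oo, x]) (f_ n t)%:E)%E @[n --> \oo] --> (prim f x)%:E.
  rewrite /prim /Rintegral fineK; last exact: integrable_fin_num (intgS _ fi).
  apply: (@dominated_cvg _ _ _ mu _ _ _ _ (fun t => (g t)%:E)) => //.
  - by move=> n; apply/measurable_EFinP; apply: measurable_funTS; exact: mf.
  - by move=> t _; apply: cvg_EFin; [exact: nearW|exact: cf].
  - exact: intgS.
  - by move=> n t _; rewrite lee_fin.
exact: (fine_cvg H).
Qed.

(** The sequence is its first term plus a series of increments dominated by a geometric series. *)
Lemma cvg_geometric_steps (x_ : nat -> R) (q : R) : 0 <= q < 1 ->
  (forall n, `|x_ n.+1 - x_ n| <= q ^+ n) -> cvgn x_.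
Proof.
move=> /andP[q0 q1] xq.
pose d_ n := x_ n.+1 - x_ n.
have -> : x_ = (fun n => x_ 0%N + series d_ n).
  apply/funext => n; rewrite /series /= telescope_sumr //.
  by rewrite addrC subrK.
apply: is_cvgD; first exact: is_cvg_cst.
apply: normed_cvg; apply: (@series_le_cvg _ _ (fun n => q ^+ n)) => //.
  - by move=> n; exact: normr_ge0.
  - by move=> n; apply: exprn_ge0.
- have -> : (fun n => q ^+ n) = geometric 1 q.
    by apply/funext => n; rewrite /geometric /= mul1r.
  by apply: is_cvg_geometric_series; rewrite ger0_norm.
Qed.

(** The integrand is at most [B * (|w| + |r| + |s|)]. The bound is applied with [(w, r, s)] to the
    first equation of the system and with [(r, s, w)] to the second. *)
Lemma prim_pair_le w r s f g B x : intg w -> intg r -> intg s ->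
  \int[mu]_t (`|w t| + `|r t| + `|s t|) <= 1 / 4 -> 0 <= B ->
  measurable_fun setT f -> measurable_fun setT g ->
  bounded_by B f -> bounded_by B g ->
  `|prim (fun t => w t * g t + r t * f t) x| <= B / 4.
Proof.
move=> hw hr hs small B0 mf mg fB gB.
have im : intg (fun t => `|w t| + `|r t| + `|s t|).
  by apply: intgD; [apply: intgD|]; exact: intg_norm.
have iB : intg (fun t => (`|w t| + `|r t| + `|s t|) * B).
  by apply: (@intgM _ _ _ B) => // t; rewrite ger0_norm.
apply: le_trans (prim_norm_le x (g := fun t => (`|w t| + `|r t| + `|s t|) * B) _ iB _) _.
- by apply: intgD; [exact: (intgM hw mg gB)|exact: (intgM hr mf fB)].
- move=> t; apply: le_trans (ler_normD _ _) _; rewrite !normrM.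
  have h1 : `|w t| * `|g t| <= `|w t| * B by apply: ler_wpM2l.
  have h2 : `|r t| * `|f t| <= `|r t| * B by apply: ler_wpM2l.
  have h3 : 0 <= `|s t| * B by apply: mulr_ge0.
  rewrite !mulrDl; lra.
- rewrite RintegralZr //.
  have h := ler_wpM2r B0 small.
  lra.
Qed.

(** * The fixed point of the Picard operator *)

Section Solution.
Variables (w r s : R -> R) (alpha beta : R).
Hypotheses (hw : intg w) (hr : intg r) (hs : intg s).
Hypothesis small : \int[mu]_t (`|w t| + `|r t| + `|s t|) <= 1 / 4.
Hypotheses (alpha1 : `|alpha| <= 1) (beta1 : `|beta| <= 1).

(** A fixed point solves the homogeneous system with value [(alpha, beta)] at minus infinity. *)
Let picard_step (z : (R -> R) * (R -> R)) : (R -> R) * (R -> R) :=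
  (fun x => alpha + prim (fun t => w t * z.2 t + r t * z.1 t) x,
   fun x => beta - prim (fun t => r t * z.2 t + s t * z.1 t) x).

Let z_ n := iter n picard_step (fun=> alpha, fun=> beta).

Let small' : \int[mu]_t (`|r t| + `|s t| + `|w t|) <= 1 / 4.
Proof.
rewrite [leLHS](_ : _ = \int[mu]_t (`|w t| + `|r t| + `|s t|)) //.
by apply: eq_Rintegral => t _; rewrite addrC addrA.
Qed.

(** The radius 4/3 is preserved: one step moves at most (4/3)/4 = 1/3 away from [alpha] or [beta],
    which have modulus at most 1. *)
Let good (z : (R -> R) * (R -> R)) :=
  [/\ measurable_fun setT z.1, measurable_fun setT z.2,
      bounded_by (4 / 3) z.1 & bounded_by (4 / 3) z.2].

Let intw z : good z -> intg (fun t => w t * z.2 t + r t * z.1 t).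
Proof.
case=> m1 m2 b1 b2.
by apply: intgD; [exact: (intgM hw m2 b2)|exact: (intgM hr m1 b1)].
Qed.

Let intr z : good z -> intg (fun t => r t * z.2 t + s t * z.1 t).
Proof.
case=> m1 m2 b1 b2.
by apply: intgD; [exact: (intgM hr m2 b2)|exact: (intgM hs m1 b1)].
Qed.

Let step_le z x : good z ->
  `|(picard_step z).1 x - alpha| <= 1 / 3 /\ `|(picard_step z).2 x - beta| <= 1 / 3.
Proof.
case=> m1 m2 b1 b2; rewrite /= (addrC alpha) addrK (addrC beta) addrK normrN.
have p : 0 <= 4 / 3 :> R by lra.
have h1 := prim_pair_le x hw hr hs small p m1 m2 b1 b2.
have h2 := prim_pair_le x hr hs hw small' p m1 m2 b1 b2.
by split; [apply: le_trans h1 _|apply: le_trans h2 _]; lra.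
Qed.

Let good_step z : good z -> good (picard_step z).
Proof.
move=> gz; split.
- by apply: measurable_funD => //; exact: measurable_prim (intw gz).
- by apply: measurable_funB => //; exact: measurable_prim (intr gz).
- move=> x; have [h _] := step_le x gz.
  rewrite -[X in `|X|](subrK alpha); apply: le_trans (ler_normD _ _) _.
  by apply: le_trans (lerD h alpha1) _; lra.
- move=> x; have [_ h] := step_le x gz.
  rewrite -[X in `|X|](subrK beta); apply: le_trans (ler_normD _ _) _.
  by apply: le_trans (lerD h beta1) _; lra.
Qed.

Let good_z n : good (z_ n).
Proof.
elim: n => [|n IH]; last exact: good_step.
by split=> //= x; [apply: le_trans alpha1 _|apply: le_trans beta1 _]; lra.
Qed.

Let z_le n x : `|(z_ n).1 x - alpha| <= 1 / 3 /\ `|(z_ n).2 x - beta| <= 1 / 3.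
Proof.
case: n => [|n]; last exact: step_le (good_z n).
by rewrite /= !subrr normr0; split; lra.
Qed.

(** By linearity the difference of two images is again a primitive of the kind estimated above, so
    the step contracts the sup norm by the factor 1/4. *)
Let step_dist y z B x : 0 <= B -> good y -> good z ->
  bounded_by B (fun t => y.1 t - z.1 t) -> bounded_by B (fun t => y.2 t - z.2 t) ->
  `|(picard_step y).1 x - (picard_step z).1 x| <= B / 4 /\
  `|(picard_step y).2 x - (picard_step z).2 x| <= B / 4.
Proof.
move=> B0 gy gz yz1 yz2; have [my1 my2 _ _] := gy; have [mz1 mz2 _ _] := gz.
have m1 : measurable_fun setT (fun t => y.1 t - z.1 t) by exact: measurable_funB.
have m2 : measurable_fun setT (fun t => y.2 t - z.2 t) by exact: measurable_funB.
have e1 (c p q : R) : c + p - (c + q) = p - q by ring.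
have e2 (c p q : R) : c - p - (c - q) = - (p - q) by ring.
rewrite /= e1 e2 normrN.
rewrite (primB2 x (intw gy) (intw gz)) (primB2 x (intr gy) (intr gz)).
have h1 := prim_pair_le x hw hr hs small B0 m1 m2 yz1 yz2.
have h2 := prim_pair_le x hr hs hw small' B0 m1 m2 yz1 yz2.
split; [move: h1|move: h2]; apply: le_trans; rewrite le_eqVlt; apply/orP; left; apply/eqP;
  by congr `|_|; apply: eq_prim => t; ring.
Qed.

Let z_dist n x : `|(z_ n.+1).1 x - (z_ n).1 x| <= 4^-1 ^+ n /\
                 `|(z_ n.+1).2 x - (z_ n).2 x| <= 4^-1 ^+ n.
Proof.
elim: n x => [|n IH] x.
  (* The iteration starts at the constants [alpha] and [beta], so the first increment is at most
     1/3, below [4^-1 ^+ 0 = 1]. *)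
  by have [h1 h2] := z_le 1 x; rewrite expr0; split; [move: h1|move: h2]; rewrite /=; lra.
rewrite exprSr.
have q0 : 0 <= 4^-1 ^+ n :> R by apply: exprn_ge0; lra.
apply: (step_dist x q0 (good_z n.+1) (good_z n)).
- by move=> t; have [] := IH t.
- by move=> t; have [] := IH t.
Qed.

(** The geometric increments make the iterates converge pointwise, and the distance 1/3 from the
    initial values survives in the limit. *)
Lemma picard_solution : exists u v,
  [/\ forall x, `|u x - alpha| <= 1 / 3, forall x, `|v x - beta| <= 1 / 3,
      intg (fun t => w t * v t + r t * u t) /\ intg (fun t => r t * v t + s t * u t),
      forall x, u x = alpha + prim (fun t => w t * v t + r t * u t) x &
      forall x, v x = beta - prim (fun t => r t * v t + s t * u t) x].
Proof.
pose u x := limn (fun n => (z_ n).1 x).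
pose v x := limn (fun n => (z_ n).2 x).
have q1 : 0 <= (4^-1 : R) < 1 by apply/andP; split; lra.
have cu x : (z_ n).1 x @[n --> \oo] --> u x.
  by apply: (cvg_geometric_steps q1) => n; have [] := z_dist n x.
have cv x : (z_ n).2 x @[n --> \oo] --> v x.
  by apply: (cvg_geometric_steps q1) => n; have [] := z_dist n x.
have u3 x : `|u x - alpha| <= 1 / 3.
  by apply: (le_norm_lim (cu x)) => n; have [] := z_le n x.
have v3 x : `|v x - beta| <= 1 / 3.
  by apply: (le_norm_lim (cv x)) => n; have [] := z_le n x.
have gz : good (u, v).
  split=> /=.
  - by apply: measurable_fun_cvg (fun x _ => cu x) => n; have [] := good_z n.
  - by apply: measurable_fun_cvg (fun x _ => cv x) => n; have [] := good_z n.
  - move=> x; rewrite -[X in `|X|](subrK alpha); apply: le_trans (ler_normD _ _) _.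
    by apply: le_trans (lerD (u3 x) alpha1) _; lra.
  - move=> x; rewrite -[X in `|X|](subrK beta); apply: le_trans (ler_normD _ _) _.
    by apply: le_trans (lerD (v3 x) beta1) _; lra.
(* All iterates are bounded by 4/3, which gives the dominating function [(|f| + |g|) * (4 / 3)]. *)
have limp (f g : R -> R) x : intg f -> intg g ->
    prim (fun t => f t * (z_ n).2 t + g t * (z_ n).1 t) x @[n --> \oo] -->
    prim (fun t => f t * v t + g t * u t) x.
  move=> fi gi; apply: (@prim_cvg _ _ (fun t => (`|f t| + `|g t|) * (4 / 3))).
  - move=> n; have [m1 m2 _ _] := good_z n.
    by apply: measurable_funD; apply: measurable_funM => //; exact: intg_measurable.
  - move=> t; apply: cvgD; apply: cvgM; try exact: cvg_cst.
      exact: cv.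
    exact: cu.
  - apply: (@intgM _ _ _ (4 / 3)) => //; last by move=> t; rewrite ger0_norm; lra.
    by apply: intgD; exact: intg_norm.
  - move=> n t; have [_ _ b1 b2] := good_z n.
    apply: le_trans (ler_normD _ _) _; rewrite !normrM mulrDl.
    by apply: lerD; apply: ler_wpM2l.
exists u, v; split => //.
- by split; [exact: intw gz|exact: intr gz].
- move=> x; have h : (z_ n.+1).1 x @[n --> \oo] --> u x.
    by rewrite (@cvg_shiftS _ (fun n => (z_ n).1 x)); exact: cu.
  apply: (cvg_unique _ h) => //.
  by apply: cvgD; [exact: cvg_cst|exact: limp].
- move=> x; have h : (z_ n.+1).2 x @[n --> \oo] --> v x.
    by rewrite (@cvg_shiftS _ (fun n => (z_ n).2 x)); exact: cv.
  apply: (cvg_unique _ h) => //.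
  by apply: cvgB; [exact: cvg_cst|exact: limp].
Qed.

End Solution.

End Picard.

(** * Controllability on a short interval *)

Section Steering.
Context {R : realType}.
Notation mu := (@lebesgue_measure R).
Implicit Types f g u v : R -> R.

(** A nonzero value would persist, by continuity, on a nonempty open subinterval, which is not
    negligible. *)
Lemma ae_zero_continuous f (c d : R) : c < d ->
  (forall x, x \in `[c, d] -> forall e : R, 0 < e -> exists2 D : R, 0 < D &
     forall y, y \in `[c, d] -> `|y - x| < D -> `|f y - f x| < e) ->
  {ae mu, forall x, x \in `]c, d[ -> f x = 0} ->
  forall x, x \in `[c, d] -> f x = 0.
Proof.
move=> cd cf f0 x xcd; apply/eqP; apply/negPn/negP => fx0.
have fx : 0 < `|f x| by rewrite normr_gt0.
have [D D0 HD] := cf x xcd _ fx.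
(* []lo, hi[] is the part of []c, d[] at distance less than [D] from [x]; it is nonempty even if [x]
   is an end-point. *)
pose lo := Num.max c (x - D); pose hi := Num.min d (x + D).
move: (xcd); rewrite in_itv /= => /andP[cx xd].
have lohi : lo < hi.
  rewrite /lo /hi lt_min !gt_max cd /=; apply/andP; split; last by apply/andP; split; lra.
  lra.
have neg : mu.-negligible `]lo, hi[.
  apply: negligibleS f0 => y /=.
  rewrite in_itv /= gt_max lt_min => /andP[/andP[cy xy] /andP[yd yx]] fy.
  have ycd : y \in `]c, d[ by rewrite in_itv /= cy.
  have := HD y; rewrite fy // sub0r normrN ltxx => H.
  suff: false by [].
  by apply: H; [rewrite in_itv /= !ltW|rewrite ltr_distlC; apply/andP; split; lra].
have h0 : mu `]lo, hi[ = 0%E by apply: measure_negligible => //; exact: measurable_itv.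
move: h0.
rewrite lebesgue_measure_itv /= lte_fin lohi => /eqP.
by rewrite -EFinB eqe subr_eq0 gt_eqF.
Qed.

Lemma abs_cont_ae_zero f (c d : R) : c < d -> abs_cont f ->
  {ae mu, forall x, x \in `]c, d[ -> f x = 0} ->
  forall x, x \in `[c, d] -> f x = 0.
Proof.
move=> cd acf; apply: ae_zero_continuous => // x _ e e0.
have [D D0 HD] := abs_cont_cont acf e0; exists D => // y _.
have [xy|yx|->] := ltgtP x y.
- by move=> h; apply: HD => //; apply: le_lt_trans h; exact: ler_norm.
- rewrite distrC => h; rewrite distrC; apply: HD => //.
  by apply: le_lt_trans h; exact: ler_norm.
- by rewrite !subrr normr0.
Qed.

(** Bounded Borel functions form a ring of multipliers that preserve integrability. *)
Definition bmeas f := measurable_fun setT f /\ exists M, bounded_by M f.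

Lemma bmeas_ac f g : ac_deriv f g -> bmeas f.
Proof.
by case=> af bf _; split=> //; apply: continuous_measurable_fun; exact: abs_cont_continuous.
Qed.

Lemma bmeas_cst (k : R) : bmeas (fun=> k).
Proof. by split; [exact: measurable_cst|exists `|k|]. Qed.

Lemma bmeasD f g : bmeas f -> bmeas g -> bmeas (fun x => f x + g x).
Proof.
move=> [mf [M fM]] [mg [N gN]]; split; first exact: measurable_funD.
exists (M + N) => x; apply: le_trans (ler_normD _ _) _.
by apply: lerD.
Qed.

Lemma bmeasM f g : bmeas f -> bmeas g -> bmeas (fun x => f x * g x).
Proof.
move=> [mf [M fM]] [mg [N gN]]; split; first exact: measurable_funM.
by exists (M * N) => x; rewrite normrM; apply: ler_pM.
Qed.

Lemma bmeas_indic (i : interval R) : bmeas \1_[set` i].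
Proof.
split; first by apply: measurable_indic; exact: measurable_itv.
by exists 1 => x; rewrite indicE ger0_norm // lern1 leq_b1.
Qed.

Lemma intgM_bmeas f g : intg f -> bmeas g -> intg (fun x => f x * g x).
Proof. by move=> fi [mg [M gM]]; exact: (intgM fi mg gM). Qed.

Lemma Rintegral_lin (k l : R) f g : intg f -> intg g ->
  \int[mu]_t (k * f t + l * g t) = k * \int[mu]_t f t + l * \int[mu]_t g t.
Proof.
move=> fi gi; rewrite RintegralD ?RintegralZl //.
  by have := intgM_bmeas fi (bmeas_cst k); apply: eq_integrable => // t _; rewrite /= mulrC.
by have := intgM_bmeas gi (bmeas_cst l); apply: eq_integrable => // t _; rewrite /= mulrC.
Qed.

Definition off_zero (c d : R) f := forall x, x \notin `]c, d[ -> f x = 0.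

Lemma prim_le_off f (c d x : R) : off_zero c d f -> x <= c -> prim f x = 0.
Proof.
move=> f0 xc; rewrite /prim (@eq_Rintegral _ _ _ mu _ (fun=> 0)) ?Rintegral_cst ?mul0r//.
move=> t; rewrite inE /= in_itv /= => tx; apply: f0.
by rewrite in_itv /= negb_and -leNgt (le_trans tx xc).
Qed.

Lemma prim_ge_off f (c d x : R) : off_zero c d f -> d <= x ->
  prim f x = \int[mu]_t f t.
Proof.
move=> f0 dx; rewrite /prim Rintegral_mkcond; apply: eq_Rintegral => t _.
rewrite patchE; case: ifPn => // tx; rewrite f0 // in_itv /= negb_and -!leNgt.
apply/orP; right; apply: le_trans dx _; rewrite leNgt; apply/negP => tx'.
by move/negP: tx; apply; rewrite inE /= in_itv /= ltW.
Qed.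

(** With [w = 1/p], [r = Q/p], [s = Q^2/p], the function [z] is the quasi-derivative of [y] and [F]
    is its second quasi-derivative. Boundedness of [F] will put it in L_2. *)
Definition ode_pair (w r s y z : R -> R) := exists F,
  [/\ bmeas F,
      ac_deriv y (fun x => w x * z x + r x * y x) &
      ac_deriv z (fun x => F x - (r x * z x + s x * y x))].

Section Control.
Variables (c d : R) (w r s : R -> R).
Hypotheses (cd : c < d) (hw : intg w) (hr : intg r) (hs : intg s).
Hypothesis small : \int[mu]_t (`|w t| + `|r t| + `|s t|) <= 1 / 4.
Hypotheses (w0 : off_zero c d w) (r0 : off_zero c d r) (s0 : off_zero c d s).
Hypothesis wn0 : {ae mu, forall x, x \in `]c, d[ -> w x != 0}.

(** The coefficients vanish off []c, d[], so solutions are constant on either side. The bound 1/3 is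
    what makes the two fundamental solutions independent at [d]. *)
Definition hom_sol (alpha beta : R) u v :=
  [/\ ac_deriv u (fun t => w t * v t + r t * u t),
      ac_deriv v (fun t => - (r t * v t + s t * u t)),
      forall x, x <= c -> u x = alpha /\ v x = beta,
      forall x, d <= x -> u x = u d /\ v x = v d &
      forall x, `|u x - alpha| <= 1 / 3 /\ `|v x - beta| <= 1 / 3].

Lemma hom_solution (alpha beta : R) : `|alpha| <= 1 -> `|beta| <= 1 ->
  exists u v, hom_sol alpha beta u v.
Proof.
move=> a1 b1; have [u [v [u3 v3 [iu iv] ue ve]]] := picard_solution hw hr hs small a1 b1.
have ou : off_zero c d (fun t => w t * v t + r t * u t).
  by move=> x xcd; rewrite w0 // r0 // !mul0r addr0.
have ov : off_zero c d (fun t => r t * v t + s t * u t).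
  by move=> x xcd; rewrite r0 // s0 // !mul0r addr0.
exists u, v; split.
- have := ac_derivD (ac_deriv_cst alpha) (ac_deriv_prim iu).
  rewrite (_ : (fun x => _ + prim _ x) = u); last by apply/funext => x; rewrite ue.
  rewrite (_ : (fun x => 0 + _) = fun t => w t * v t + r t * u t) //.
  by apply/funext => x; rewrite add0r.
- have := ac_derivD (ac_deriv_cst beta) (ac_derivM (ac_deriv_cst (-1)) (ac_deriv_prim iv)).
  rewrite (_ : (fun x => _ + _ * prim _ x) = v); last by apply/funext => x; rewrite ve mulN1r.
  rewrite (_ : (fun x => 0 + _) = fun t => - (r t * v t + s t * u t)) //.
  by apply/funext => x; ring.
- by move=> x xc; rewrite ue ve (prim_le_off ou xc) (prim_le_off ov xc) addr0 subr0.
- move=> x dx; rewrite (ue x) (ve x) (ue d) (ve d).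
  by rewrite (prim_ge_off ou dx) (prim_ge_off ov dx)
    (prim_ge_off ou (lexx d)) (prim_ge_off ov (lexx d)).
- by [].
Qed.

(** * The Gram matrix of a fundamental system and variation of constants *)

Section Fundamental.
Variables e1 z1 e2 z2 : R -> R.
Hypotheses (H1 : hom_sol 1 0 e1 z1) (H2 : hom_sol 0 1 e2 z2).

(** Multiplication by this indicator makes a bounded function integrable on the line and confines
    the control to []c, d[]. *)
Let chi : R -> R := \1_`]c, d[.

Let ne1 : bmeas e1. Proof. by case: H1 => /bmeas_ac. Qed.
Let ne2 : bmeas e2. Proof. by case: H2 => /bmeas_ac. Qed.
Let nz1 : bmeas z1. Proof. by case: H1 => _ /bmeas_ac. Qed.
Let nz2 : bmeas z2. Proof. by case: H2 => _ /bmeas_ac. Qed.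

Let chi_intg f : bmeas f -> intg (fun t => chi t * f t).
Proof. by apply: intgM_bmeas; exact: integrable_indic_itv. Qed.

Let chi1 x : x \in `]c, d[ -> chi x = 1.
Proof. by move=> xcd; rewrite /chi indicE mem_set. Qed.

Let chi0 x : x \notin `]c, d[ -> chi x = 0.
Proof. by move=> xcd; rewrite /chi indicE memNset //; apply/negP. Qed.

Let chi_ge0 x : 0 <= chi x.
Proof. by rewrite /chi indicE ler0n. Qed.

Let hom_comb (k1 k2 : R) : exists u v,
  [/\ u = (fun x => k1 * e1 x + k2 * e2 x), v = (fun x => k1 * z1 x + k2 * z2 x),
      ac_deriv u (fun t => w t * v t + r t * u t) &
      ac_deriv v (fun t => - (r t * v t + s t * u t))].
Proof.
case: H1 => de1 dz1 _ _ _; case: H2 => de2 dz2 _ _ _.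
do 2 eexists; split; first by []; first by [].
- have := ac_derivD (ac_derivM (ac_deriv_cst k1) de1) (ac_derivM (ac_deriv_cst k2) de2).
  congr ac_deriv; apply/funext => x; ring.
- have := ac_derivD (ac_derivM (ac_deriv_cst k1) dz1) (ac_derivM (ac_deriv_cst k2) dz2).
  congr ac_deriv; apply/funext => x; ring.
Qed.

Let gram_definite (k1 k2 : R) :
  \int[mu]_t (chi t * (k1 * e1 t + k2 * e2 t) ^+ 2) = 0 -> k1 = 0 /\ k2 = 0.
Proof.
have [u [v [ue ve du dv]]] := hom_comb k1 k2.
rewrite (_ : (fun t => _) = fun t => chi t * (u t * u t)); last first.
  by apply/funext => t; rewrite ue expr2.
move=> int0.
have nu := bmeas_ac du.
have iu := chi_intg (bmeasM nu nu).
have u0 : {ae mu, forall x, x \in `]c, d[ -> u x = 0}.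
  have [+ _] := ae_eq_integral_abs mu measurableT (measurable_int _ iu).
  have -> : (\int[mu]_x `|(EFin \o (fun t => chi t * (u t * u t))%R) x| = 0)%E.
    have <- : (\int[mu]_t (EFin \o (fun t => chi t * (u t * u t))%R) t = 0)%E.
      rewrite -[LHS]fineK; last exact: integrable_fin_num iu.
      by apply/eqP; rewrite eqe; apply/eqP; exact: int0.
    apply: eq_integral => t _ /=; congr EFin; apply: ger0_norm.
    by rewrite mulr_ge0 ?chi_ge0 // -expr2 sqr_ge0.
  move=> /(_ erefl); apply: ae_imply => x /(_ I) /= [].
  by move=> + xcd; rewrite chi1 // mul1r => /eqP; rewrite mulf_eq0 orbb => /eqP.
have {}u0 := abs_cont_ae_zero cd (let: And3 a _ _ := du in a) u0.
(* Since [u] vanishes near each interior point, its derivative [w v + r u] is 0 almost everywhere,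
   and there it reduces to [w v] with [w] nonzero. *)
have v0 : {ae mu, forall x, x \in `]c, d[ -> v x = 0}.
  have [_ _ ddu] := du.
  apply: ae_imply2 ddu wn0 => x dux wx xcd.
  have du0 : is_derive x (1 : R) u 0.
    apply: (@near_eq_is_derive _ _ _ (fun=> 0)).
      near=> y; apply/esym/u0; apply: subset_itv_oo_cc.
      by near: y; exact: near_in_itvoo.
  have := @derive_val _ _ _ _ _ _ _ dux; rewrite (@derive_val _ _ _ _ _ _ _ du0).
  rewrite u0 ?mulr0 ?addr0; last exact: subset_itv_oo_cc xcd.
  by move=> /esym/eqP; rewrite mulf_eq0 (negbTE (wx xcd)) => /eqP.
have {}v0 := abs_cont_ae_zero cd (let: And3 a _ _ := dv in a) v0.
have ccd : c \in `[c, d] by rewrite in_itv /= lexx ltW.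
case: H1 => _ _ /(_ c (lexx c)) [e1c z1c] _ _; case: H2 => _ _ /(_ c (lexx c)) [e2c z2c] _ _.
move: (u0 c ccd) (v0 c ccd); rewrite ue ve e1c e2c z1c z2c.
by rewrite !mulr1 !mulr0 addr0 add0r.
Unshelve. all: by end_near. Qed.

Let gram f g := \int[mu]_t (chi t * (f t * g t)).

Let gram_quad (k1 k2 : R) :
  \int[mu]_t (chi t * (k1 * e1 t + k2 * e2 t) ^+ 2) =
  k1 ^+ 2 * gram e1 e1 + 2 * k1 * k2 * gram e1 e2 + k2 ^+ 2 * gram e2 e2.
Proof.
have i11 := chi_intg (bmeasM ne1 ne1).
have i12 := chi_intg (bmeasM ne1 ne2).
have i22 := chi_intg (bmeasM ne2 ne2).
have i := chi_intg (bmeasM (bmeasD (bmeasM (bmeas_cst k1) ne1)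
  (bmeasM (bmeas_cst (2 * k2)) ne2)) ne1).
(* The square is grouped as [k1 e1 (k1 e1 + 2 k2 e2) + k2^2 e2^2], so that linearity for two
   summands, used twice, suffices. *)
transitivity (\int[mu]_t (1 * (chi t * ((k1 * e1 t + 2 * k2 * e2 t) * e1 t) * k1)
   + k2 ^+ 2 * (chi t * (e2 t * e2 t)))).
  by apply: eq_Rintegral => t _; ring.
rewrite Rintegral_lin //; last exact: intgM_bmeas i (bmeas_cst k1).
rewrite mul1r RintegralZr //; congr (_ + _).
transitivity ((\int[mu]_t (k1 * (chi t * (e1 t * e1 t)) +
    2 * k2 * (chi t * (e1 t * e2 t)))) * k1).
  by congr (_ * _); apply: eq_Rintegral => t _; ring.
by rewrite Rintegral_lin // /gram; ring.
Qed.

(** At the vector [(- gram e1 e2, gram e1 e1)] the quadratic form equals [gram e1 e1] times the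
    determinant, so a zero determinant contradicts definiteness. *)
Let gram_det : gram e1 e1 * gram e2 e2 - gram e1 e2 ^+ 2 != 0.
Proof.
apply/eqP => det0.
have g11 : gram e1 e1 != 0.
  apply/eqP => g0; have [] := @gram_definite 1 0.
    by rewrite gram_quad g0; ring.
  by move=> /eqP; rewrite oner_eq0.
have [] := @gram_definite (- gram e1 e2) (gram e1 e1).
  rewrite gram_quad -[RHS](mulr0 (gram e1 e1)) -det0; ring.
by move=> _ /eqP; rewrite (negbTE g11).
Qed.

Let steer (A1 A2 : R) : exists f, [/\ bmeas f, intg f, off_zero c d f,
  \int[mu]_t (f t * e1 t) = A1 & \int[mu]_t (f t * e2 t) = A2].
Proof.
pose D := gram e1 e1 * gram e2 e2 - gram e1 e2 ^+ 2.
(* Cramer's rule for the Gram system with right-hand side [(A1, A2)]. *)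
pose c1 := (A1 * gram e2 e2 - A2 * gram e1 e2) / D.
pose c2 := (A2 * gram e1 e1 - A1 * gram e1 e2) / D.
have ng : bmeas (fun t => c1 * e1 t + c2 * e2 t).
  by apply: bmeasD; apply: bmeasM => //; exact: bmeas_cst.
have i11 := chi_intg (bmeasM ne1 ne1).
have i12 := chi_intg (bmeasM ne1 ne2).
have i22 := chi_intg (bmeasM ne2 ne2).
exists (fun t => chi t * (c1 * e1 t + c2 * e2 t)); split.
- by apply: bmeasM => //; exact: bmeas_indic.
- exact: chi_intg.
- by move=> x xcd; rewrite chi0 // mul0r.
- transitivity (\int[mu]_t (c1 * (chi t * (e1 t * e1 t)) + c2 * (chi t * (e1 t * e2 t)))).
    by apply: eq_Rintegral => t _; ring.
  rewrite Rintegral_lin // -/(gram e1 e1) -/(gram e1 e2) /c1 /c2 /D.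
  by field; exact: gram_det.
- transitivity (\int[mu]_t (c1 * (chi t * (e1 t * e2 t)) + c2 * (chi t * (e2 t * e2 t)))).
    by apply: eq_Rintegral => t _; ring.
  rewrite Rintegral_lin // -/(gram e1 e2) -/(gram e2 e2) /c1 /c2 /D.
  by field; exact: gram_det.
Qed.

Lemma transfer_of_fundamental (a1 a2 b1 b2 : R) : exists y z,
  [/\ ode_pair w r s y z,
      forall x, x <= c -> y x = a1 /\ z x = a2 &
      forall x, d <= x -> y x = b1 /\ z x = b2].
Proof.
case: (H1) => de1 dz1 e1c e1d e1b; case: (H2) => de2 dz2 e2c e2d e2b.
(* The bounds at [d] give [e1, z2 >= 2/3] and [|e2|, |z1| <= 1/3], hence [D >= 4/9 - 1/9 > 0]. *)
pose D := e1 d * z2 d - e2 d * z1 d.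
have D0 : D != 0.
  have [] := e1b d; have [] := e2b d; rewrite /D !ler_distl.
  move=> /andP[? ?] /andP[? ?] /andP[? ?] /andP[? ?].
  suff : 0 < e1 d * z2 d - e2 d * z1 d by move=> /gt_eqF ->.
  nra.
(* The quotients by [D] are the coefficients that produce [(b1, b2)] at [d]. As [k1' = f e2] and
   [k2' = - f e1], the integrals of [f e1] and [f e2] must be minus the increment of [k2] and the
   increment of [k1]. *)
have [f [nf fi f0 fe1 fe2]] := steer
  (- ((b2 * e1 d - b1 * z1 d) / D - a2)) ((b1 * z2 d - b2 * e2 d) / D - a1).
have i1 := intgM_bmeas fi ne1.
have i2 := intgM_bmeas fi ne2.
have dk1 := ac_derivD (ac_deriv_cst a1) (ac_deriv_prim i2).
have dk2 := ac_derivD (ac_deriv_cst a2) (ac_derivM (ac_deriv_cst (-1)) (ac_deriv_prim i1)).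
have o1 : off_zero c d (fun t => f t * e1 t) by move=> x /f0 ->; rewrite mul0r.
have o2 : off_zero c d (fun t => f t * e2 t) by move=> x /f0 ->; rewrite mul0r.
pose k1 x := a1 + prim (fun t => f t * e2 t) x.
pose k2 x := a2 + -1 * prim (fun t => f t * e1 t) x.
have dy := ac_derivD (ac_derivM dk1 de1) (ac_derivM dk2 de2).
have dz := ac_derivD (ac_derivM dk1 dz1) (ac_derivM dk2 dz2).
exists (fun x => k1 x * e1 x + k2 x * e2 x), (fun x => k1 x * z1 x + k2 x * z2 x); split.
(* The derivatives of [k1] and [k2] contribute [k1' e1 + k2' e2 = 0] to the first equation and
   [k1' z1 + k2' z2], which is this [F], to the second. *)
- exists (fun t => f t * (e2 t * z1 t - e1 t * z2 t)); split.
  + apply: bmeasM => //.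
    have nN := bmeasM (bmeas_cst (-1)) (bmeasM ne1 nz2).
    have := bmeasD (bmeasM ne2 nz1) nN.
    by congr bmeas; apply/funext => t; rewrite mulN1r.
  + move: dy; congr ac_deriv; apply/funext => t; rewrite /k1 /k2; ring.
  + move: dz; congr ac_deriv; apply/funext => t; rewrite /k1 /k2; ring.
- move=> x xc; rewrite /k1 /k2 /=; have [-> ->] := e1c x xc; have [-> ->] := e2c x xc.
  by rewrite (prim_le_off o1 xc) (prim_le_off o2 xc); split; ring.
- move=> x dx; rewrite /k1 /k2 /=; have [-> ->] := e1d x dx; have [-> ->] := e2d x dx.
  rewrite (prim_ge_off o1 dx) (prim_ge_off o2 dx) fe1 fe2.
  by split; rewrite /D; field; exact: D0.
Qed.

End Fundamental.
Lemma transfer (a1 a2 b1 b2 : R) : exists y z,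
  [/\ ode_pair w r s y z,
      forall x, x <= c -> y x = a1 /\ z x = a2 &
      forall x, d <= x -> y x = b1 /\ z x = b2].
Proof.
have n0 : `|0 : R| <= 1 by rewrite normr0 ler01.
have n1 : `|1 : R| <= 1 by rewrite normr1.
have [e1 [z1 H1]] := hom_solution n1 n0.
have [e2 [z2 H2]] := hom_solution n0 n1.
exact: transfer_of_fundamental H1 H2 _ _ _ _.
Qed.

End Control.
End Steering.

(** * Functions with prescribed boundary values at one end-point *)

Section RealPairs.
Context {R : realType}.
Notation mu := (@lebesgue_measure R).
Variables (a b : R) (w r s : R -> R).
Hypothesis ab : a < b.

(** The equations use the full coefficients and are required only inside []a, b[]; pairs built near
    different end-points can thus be added. *)
Definition real_pair (y z : R -> R) := exists F,
  [/\ bmeas F, abs_cont y /\ bmeas y,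
      abs_cont z /\ bmeas z,
      ae_on a b (fun x => is_derive x (1 : R) y (w x * z x + r x * y x)) &
      ae_on a b (fun x => is_derive x (1 : R) z (F x - (r x * z x + s x * y x)))].

Lemma real_pair0 : real_pair (fun=> 0) (fun=> 0).
Proof.
have [a0 b0 d0] := @ac_deriv_cst R 0; have n0 := @bmeas_cst R 0.
exists (fun=> 0); split => //; apply: ae_imply d0 => x; rewrite !mulr0 ?addr0 ?subr0 //.
Qed.

Lemma real_pairD y1 z1 y2 z2 : real_pair y1 z1 -> real_pair y2 z2 ->
  real_pair (fun x => y1 x + y2 x) (fun x => z1 x + z2 x).
Proof.
move=> [F1 [nF1 [ay1 ny1] [az1 nz1] dy1 dz1]] [F2 [nF2 [ay2 ny2] [az2 nz2] dy2 dz2]].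
exists (fun x => F1 x + F2 x); split.
- exact: bmeasD.
- by split; [exact: abs_contD|exact: bmeasD].
- by split; [exact: abs_contD|exact: bmeasD].
- apply: ae_imply2 dy1 dy2 => x h1 h2 xab.
  by apply: is_derive_eq (is_deriveD (h1 xab) (h2 xab)) _; ring.
- apply: ae_imply2 dz1 dz2 => x h1 h2 xab.
  by apply: is_derive_eq (is_deriveD (h1 xab) (h2 xab)) _; ring.
Qed.

Hypotheses (hw : mu.-integrable `]a, b[ (fun x => (w x)%:E))
  (hr : mu.-integrable `]a, b[ (fun x => (r x)%:E))
  (hs : mu.-integrable `]a, b[ (fun x => (s x)%:E)).
Hypothesis wn0 : ae_on a b (fun x => w x != 0).

Let intg_patch f (c d : R) : mu.-integrable `]a, b[ (fun x => (f x)%:E) ->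
  a <= c -> d <= b -> intg (f \_ `]c, d[).
Proof.
move=> fi ac db.
have cab : `]c, d[ `<=` `]a, b[ by apply: subset_itv; rewrite bnd_simp.
have fj : mu.-integrable `]c, d[ (EFin \o f).
  by apply: (integrableS _ _ _ fi) => //; exact: measurable_itv.
rewrite /intg -restrict_EFin.
exact: (integrable_mkcond (EFin \o f) (measurable_itv _)).1 fj.
Qed.

(** Absolute continuity of the integral of [|w| + |r| + |s|] gives one length [e] that makes this
    integral less than 1/4 wherever the short interval lies. *)
Lemma short_transfer : exists2 e : R, 0 < e & forall c d, a <= c -> c < d -> d <= b ->
  d - c < e -> forall a1 a2 b1 b2 : R, exists y z,
  [/\ ode_pair (w \_ `]c, d[) (r \_ `]c, d[) (s \_ `]c, d[) y z,
      forall x, x <= c -> y x = a1 /\ z x = a2 &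
      forall x, d <= x -> y x = b1 /\ z x = b2].
Proof.
pose m (x : R) := `|(w \_ `]a, b[) x| + `|(r \_ `]a, b[) x| + `|(s \_ `]a, b[) x|.
have im : intg m by apply: intgD; [apply: intgD|]; apply: intg_norm; exact: intg_patch.
have e0 : 0 < 1 / 4 :> R by lra.
have [e [e_gt0 He]] := integral_normr_continuous im e0.
exists e => // c d ac cd db dce a1 a2 b1 b2.
apply: transfer => //; try exact: intg_patch.
- have mucd : (mu `]c, d[ < e%:E)%E.
    by rewrite lebesgue_measure_itv /= lte_fin cd -EFinB lte_fin.
  have := He _ (measurable_itv _) mucd.
  move=> /ltW; apply: le_trans; rewrite [leRHS]Rintegral_mkcond.
  rewrite le_eqVlt; apply/orP; left; apply/eqP; apply: eq_Rintegral => t _.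
  rewrite !patchE; case: ifPn => [|_]; last by rewrite normr0 !addr0.
  rewrite inE /= => tcd; rewrite /m !patchE mem_set.
    by rewrite [RHS]ger0_norm ?addr_ge0.
  by apply: (subset_itv _ _) tcd; rewrite bnd_simp.
- by move=> x xcd; rewrite patchE memNset //; apply/negP.
- by move=> x xcd; rewrite patchE memNset //; apply/negP.
- by move=> x xcd; rewrite patchE memNset //; apply/negP.
- apply: ae_imply wn0 => x wx xcd; rewrite patchE mem_set //; apply: wx.
  by apply: (subset_itv _ _) xcd; rewrite bnd_simp.
Qed.

(** Off []c, d[] both functions are 0, so replacing the truncated coefficients by the full ones
    changes nothing there. *)
Let real_pair_of_ode c d y z : a <= c -> d <= b ->
  (forall x, x \in `]a, b[ -> x \notin `]c, d[ -> y x = 0 /\ z x = 0) ->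
  ode_pair (w \_ `]c, d[) (r \_ `]c, d[) (s \_ `]c, d[) y z ->
  real_pair y z.
Proof.
move=> ac db yz0 [F [nF dy dz]].
have [[ay _ ddy] [az _ ddz]] := (dy, dz).
have pE f x : x \in `]c, d[ -> (f \_ `]c, d[) x = f x :> R.
  by move=> xcd; rewrite patchE mem_set.
have p0 (f : R -> R) x : x \notin `]c, d[ -> (f \_ `]c, d[) x = 0.
  by move=> xcd; rewrite patchE memNset //; apply/negP.
exists F; split => //; first by split=> //; exact: bmeas_ac dy.
- by split=> //; exact: bmeas_ac dz.
- apply: ae_imply ddy => x h xab; apply: is_derive_eq h _.
  have [xcd|xcd] := boolP (x \in `]c, d[); first by rewrite !pE.
  by rewrite !p0 //; have [-> ->] := yz0 x xab xcd; rewrite !mul0r !mulr0.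
- apply: ae_imply ddz => x h xab; apply: is_derive_eq h _.
  have [xcd|xcd] := boolP (x \in `]c, d[); first by rewrite !pE.
  by rewrite !p0 //; have [-> ->] := yz0 x xab xcd; rewrite !mul0r !mulr0.
Qed.

(** The pair is steered from [(alpha, beta)] at [a] to [(0, 0)] at [a + h] and remains zero
    afterwards. *)
Lemma left_pair (alpha beta : R) : exists y z, [/\ real_pair y z,
  y a = alpha /\ z a = beta &
  exists2 d, d < b & forall x, d <= x -> y x = 0 /\ z x = 0].
Proof.
have [e e0 He] := short_transfer.
have ba : 0 < b - a by rewrite subr_gt0.
(* The halves give the strict inequalities [h < e] and [a + h < b]. *)
pose h := Num.min (e / 2) ((b - a) / 2).
have h0 : 0 < h by rewrite lt_min !divr_gt0 ?subr_gt0.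
have he : h < e by rewrite gt_min; apply/orP; left; lra.
have hb : h < b - a by rewrite gt_min; apply/orP; right; lra.
have ah : a < a + h by lra.
have ahb : a + h <= b by lra.
have ahe : a + h - a < e by lra.
have [y [z [ode yl yr]]] := He a (a + h) (lexx a) ah ahb ahe alpha beta 0 0.
exists y, z; split.
- apply: real_pair_of_ode ode => //.
  move=> x xab; rewrite in_itv /= negb_and -!leNgt => /orP[xa|/yr//].
  by move: xab; rewrite in_itv /= ltNge xa.
- exact: yl.
- by exists (a + h) => //; lra.
Qed.

(** The mirror construction steers from [(0, 0)] at [b - h] to [(alpha, beta)] at [b]. *)
Lemma right_pair (alpha beta : R) : exists y z, [/\ real_pair y z,
  y b = alpha /\ z b = beta &
  exists2 c, a < c & forall x, x <= c -> y x = 0 /\ z x = 0].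
Proof.
have [e e0 He] := short_transfer.
have ba : 0 < b - a by rewrite subr_gt0.
pose h := Num.min (e / 2) ((b - a) / 2).
have h0 : 0 < h by rewrite lt_min !divr_gt0 ?subr_gt0.
have he : h < e by rewrite gt_min; apply/orP; left; lra.
have hb : h < b - a by rewrite gt_min; apply/orP; right; lra.
have bh : b - h < b by lra.
have abh : a <= b - h by lra.
have bhe : b - (b - h) < e by lra.
have [y [z [ode yl yr]]] := He (b - h) b abh bh (lexx b) bhe 0 0 alpha beta.
exists y, z; split.
- apply: real_pair_of_ode ode => //.
  move=> x xab; rewrite in_itv /= negb_and -!leNgt => /orP[/yl//|bx].
  by move: xab; rewrite in_itv /= [x < b]ltNge bx andbF.
- exact: yr.
- by exists (b - h) => //; lra.
Qed.

End RealPairs.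

(** * Complex-valued functions and the maximal domain *)

Section ComplexDomain.
Context {R : realType}.
Notation mu := (@lebesgue_measure R).
Implicit Types (f g u v y z : R -> R[i]).

Lemma Re_norm_def (x : R[i]) :
  complex.Re `|x| = Num.sqrt (complex.Re x ^+ 2 + complex.Im x ^+ 2).
Proof. by rewrite normc_def. Qed.

Lemma Re_norm_le (x : R[i]) :
  complex.Re `|x| <= `|complex.Re x| + `|complex.Im x|.
Proof.
rewrite Re_norm_def -[leRHS]ger0_norm ?addr_ge0 // -sqrtr_sqr ler_wsqrtr //.
by rewrite sqrrD !real_normK ?num_real // lerD2r lerDl mulrn_wge0 // mulr_ge0.
Qed.

Lemma normRe_le (x : R[i]) : `|complex.Re x| <= complex.Re `|x|.
Proof. by rewrite Re_norm_def -sqrtr_sqr ler_wsqrtr // lerDl sqr_ge0. Qed.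

Lemma normIm_le (x : R[i]) : `|complex.Im x| <= complex.Re `|x|.
Proof. by rewrite Re_norm_def -sqrtr_sqr ler_wsqrtr // lerDr sqr_ge0. Qed.

Lemma complex_ext (x t : R[i]) :
  complex.Re x = complex.Re t -> complex.Im x = complex.Im t -> x = t.
Proof. by case: x => ? ?; case: t => ? ? /= -> ->. Qed.

Section Interval.
Variables (a b : R).
Hypothesis ab : a < b.

Lemma abs_continuous_complex (y1 y2 : R -> R) : abs_cont y1 -> abs_cont y2 ->
  abs_continuous a b (fun x => y1 x +i* y2 x).
Proof.
move=> ay1 ay2 e e0; have e2 : 0 < e / 2 by rewrite divr_gt0.
have [d d0 Hd] := ay1 _ e2; have [d' d'0 Hd'] := ay2 _ e2.
exists (Num.min d d'); first by rewrite lt_min d0.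
move=> n s t st tI; rewrite lt_min => /andP[sd sd'].
have st' k : s k < t k by have [_ []] := st k.
apply: (@le_lt_trans _ _ (\sum_(k < n) `|y1 (t k) - y1 (s k)| +
                          \sum_(k < n) `|y2 (t k) - y2 (s k)|)).
  rewrite -big_split; apply: ler_sum => k _.
  exact: (Re_norm_le ((y1 (t k) +i* y2 (t k)) - (y1 (s k) +i* y2 (s k)))).
by rewrite (splitr e) ltrD // ?Hd ?Hd'.
Qed.

Lemma abs_continuous_cont f : abs_continuous a b f -> forall x, x \in `[a, b] ->
  forall e : R, 0 < e -> exists2 D : R, 0 < D &
  forall t, t \in `[a, b] -> `|t - x| < D -> complex.Re `|f t - f x| < e.
Proof.
move=> af x xab e e0; have [D D0 HD] := af e e0; exists D => // t tab txD.
have step s' t' : s' \in `[a, b] -> t' \in `[a, b] -> s' < t' -> t' - s' < D ->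
    complex.Re `|f t' - f s'| < e.
  rewrite !in_itv /= => /andP[s1 s2] /andP[t1 t2] st tsD.
  have := HD 1%N (fun=> s') (fun=> t'); rewrite !big_ord1; apply => //.
  by move=> i j _ _ _; rewrite !ord1.
have [xt|tx|->] := ltgtP x t.
- by apply: step => //; apply: le_lt_trans txD; exact: ler_norm.
- rewrite distrC; apply: step => //; rewrite distrC in txD.
  by apply: le_lt_trans txD; exact: ler_norm.
- by rewrite subrr normr0.
Qed.

Lemma abs_continuous_ae_eq f g c d : a <= c -> c < d -> d <= b ->
  abs_continuous a b f -> abs_continuous a b g ->
  ae_on c d (fun x => f x = g x) -> forall x, x \in `[c, d] -> f x = g x.
Proof.
move=> ac cd db af ag fg.
have sub t : t \in `[c, d] -> t \in `[a, b].
  by apply: subset_itv; rewrite bnd_simp.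
(* [P] stands for the real or the imaginary part, both additive and dominated by the modulus. *)
have diff_cont (P : R[i] -> R) : (forall p q, P (p - q) = P p - P q) ->
    (forall p, `|P p| <= complex.Re `|p|) ->
  forall x, x \in `[c, d] -> P (f x - g x) = 0.
  move=> PB Ple; apply: ae_zero_continuous => //.
  - move=> x /sub xab e e0; have e2 : 0 < e / 2 by rewrite divr_gt0.
    have [D D0 HD] := abs_continuous_cont af xab e2.
    have [D' D'0 HD'] := abs_continuous_cont ag xab e2.
    exists (Num.min D D'); first by rewrite lt_min D0.
    move=> t /sub tab; rewrite lt_min => /andP[tD tD'].
    have -> : P (f t - g t) - P (f x - g x) = P (f t - f x) - P (g t - g x).
      by rewrite !PB; ring.
    apply: le_lt_trans (ler_normB _ _) _.
    apply: le_lt_trans (lerD (Ple _) (Ple _)) _.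
    by rewrite (splitr e) ltrD ?HD ?HD'.
  - apply: ae_imply fg => x fgx xcd.
    by rewrite fgx // subrr -(subrr (0 : R[i])) PB subrr.
move=> x xcd; apply/eqP; rewrite -subr_eq0; apply/eqP; apply: complex_ext => /=.
- by apply: (diff_cont (@complex.Re R)) => //; [case=> ? ? [? ?]|exact: normRe_le].
- by apply: (diff_cont (@complex.Im R)) => //; [case=> ? ? [? ?]|exact: normIm_le].
Qed.

(** Without an absolutely continuous representative [xget] returns its default [f], for which the
    equality is trivial. *)
Lemma ac_version_ae f : abs_continuous a b (ac_version a b f) ->
  ae_on a b (fun x => ac_version a b f x = f x).
Proof.
rewrite /ac_version => af.
have [h|h] := pselect (exists u, abs_continuous a b u /\ ae_on a b (fun x => u x = f x)).
  exact: (xgetPex f h).2.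
rewrite xgetPN; last by move=> u hu; apply: h; exists u.
by apply: aeW => x.
Qed.

(** Two absolutely continuous representatives agree a.e., hence by continuity on all of [[a, b]],
    end-points included. *)
Lemma ac_versionE f u : abs_continuous a b u -> ae_on a b (fun x => u x = f x) ->
  abs_continuous a b (ac_version a b f) /\
  forall x, x \in `[a, b] -> ac_version a b f x = u x.
Proof.
move=> au uf; have ex : exists u, abs_continuous a b u /\ ae_on a b (fun x => u x = f x).
  by exists u.
have [av vf] := xgetPex f ex; split => //.
apply: abs_continuous_ae_eq => //.
by apply: ae_imply2 uf vf => x h1 h2 xab; rewrite h1 // -[RHS]h2.
Qed.

Lemma in_L2_bmeas f (f1 f2 : R -> R) : bmeas f1 -> bmeas f2 ->
  ae_on a b (fun x => f x = f1 x +i* f2 x) -> in_L2 a b f.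
Proof.
move=> nf1 nf2 ff. split.
- exists f1; first by apply: measurable_funTS; exact: nf1.1.
  by apply: ae_imply ff => x h xab; rewrite h.
- exists f2; first by apply: measurable_funTS; exact: nf2.1.
  by apply: ae_imply ff => x h xab; rewrite h.
- exists (fun x => f1 x * f1 x + f2 x * f2 x).
    have [mg [M gM]] := bmeasD (bmeasM nf1 nf1) (bmeasM nf2 nf2).
    apply: measurable_bounded_integrable => //.
    + by rewrite /= lebesgue_measure_itv /= lte_fin ab -EFinB ltry.
    + exact: measurable_funTS.
    + exists M; split; first exact: num_real.
      by move=> N MN x _ /=; apply: le_trans (gM x) (ltW MN).
  apply: ae_imply ff => x h xab; rewrite h // Re_norm_def /= sqr_sqrtr.
    by rewrite !expr2.
  by rewrite addr_ge0 ?sqr_ge0.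
Qed.

Lemma cderiv_is_derive (y1 y2 : R -> R) x d1 d2 :
  is_derive x (1 : R) y1 d1 -> is_derive x (1 : R) y2 d2 ->
  cderiv (fun t => y1 t +i* y2 t) x = d1 +i* d2.
Proof.
by move=> h1 h2; rewrite /cderiv /= !derive1E !derive_val.
Qed.

Lemma near_eq_cderiv f g x : (\forall t \near x, f t = g t) -> cderiv f x = cderiv g x.
Proof.
move=> fg; rewrite /cderiv !derive1E; congr (_ +i* _); apply: near_eq_derive.
- by near=> t; congr complex.Re; near: t.
- by near=> t; congr complex.Im; near: t.
Unshelve. all: by end_near. Qed.

Section Coefficients.
Variables (p Q : R -> R).

(** The germ fixes [p y' - Q y] only almost everywhere near [c0]; continuity of the two
    quasi-derivatives then extends the equality to [c0] itself. *)
Lemma germ_boundary_values y g c0 :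
  abs_continuous a b (qderiv1 a b p Q y) -> abs_continuous a b (qderiv1 a b p Q g) ->
  c0 \in `[a, b] -> same_germ a b c0 g y ->
  g c0 = y c0 /\ qderiv1 a b p Q g c0 = qderiv1 a b p Q y c0.
Proof.
move=> aqy aqg c0ab; rewrite /same_germ near_withinE => /nbhs_ballP[e /= e0 He].
have gy x : x \in `[a, b] -> `|x - c0| < e -> g x = y x.
  by move=> xab xe; apply: He => //; rewrite /ball /= distrC.
split; first by apply: gy => //; rewrite subrr normr0.
(* Truncation at [a] and [b] gives a nondegenerate interval inside [[a, b]] that contains [c0],
   possibly as an end-point. *)
pose c := Num.max a (c0 - e / 2); pose d := Num.min b (c0 + e / 2).
move: (c0ab); rewrite in_itv /= => /andP[ac0 c0b].
have e2 : 0 < e / 2 by rewrite divr_gt0.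
have ac : a <= c by rewrite le_max lexx.
have db : d <= b by rewrite ge_min lexx.
have cc0 : c <= c0 by rewrite ge_max ac0 /=; lra.
have c0d : c0 <= d by rewrite le_min c0b /=; lra.
have c0c : c0 - e / 2 <= c by rewrite le_max lexx orbT.
have dc0 : d <= c0 + e / 2 by rewrite ge_min lexx orbT.
have cd : c < d.
  rewrite lt_min !gt_max ab /=; apply/andP; split; last by apply/andP; split; lra.
  lra.
apply: (abs_continuous_ae_eq ac cd db aqg aqy); last by rewrite in_itv /= cc0.
apply: ae_imply2 (ac_version_ae aqg) (ac_version_ae aqy) => x hg hy xcd.
have xab : x \in `]a, b[ by apply: (subset_itv _ _) xcd; rewrite bnd_simp.
have gyx t : t \in `]c, d[ -> g t = y t.
  rewrite in_itv /= => /andP[ct td]; apply: gy.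
    by rewrite in_itv /= (le_trans ac (ltW ct)) (le_trans (ltW td) db).
  by rewrite ltr_distl; apply/andP; split; lra.
rewrite [LHS]hg // [RHS]hy // gyx // (@near_eq_cderiv g y) //.
by near=> t; apply: gyx; near: t; exact: near_in_itvoo.
Unshelve. all: by end_near. Qed.

Variables (w r s : R -> R).
Hypotheses (hp0 : ae_on a b (fun x => p x != 0))
  (pw : ae_on a b (fun x => 1 / p x = w x))
  (pr : ae_on a b (fun x => Q x / p x = r x))
  (ps : ae_on a b (fun x => Q x ^+ 2 / p x = s x)).

(** From [p w = 1] and [p r = Q] the function [z1 + i z2] equals [p y' - Q y] a.e. and is therefore
    the quasi-derivative; the second one is then the bounded function [F1 + i F2] a.e. *)
Lemma real_pair_dom (y1 y2 z1 z2 : R -> R) :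
  real_pair a b w r s y1 z1 -> real_pair a b w r s y2 z2 ->
  dom_Lmax a b p Q (fun x => y1 x +i* y2 x) /\
  forall x, x \in `[a, b] -> qderiv1 a b p Q (fun x => y1 x +i* y2 x) x = z1 x +i* z2 x.
Proof.
move=> [F1 [nF1 [ay1 ny1] [az1 nz1] dy1 dz1]] [F2 [nF2 [ay2 ny2] [az2 nz2] dy2 dz2]].
pose y x := y1 x +i* y2 x; pose z x := z1 x +i* z2 x.
have az : abs_continuous a b z by exact: abs_continuous_complex.
have zE : ae_on a b (fun x => z x = (p x)%:C * cderiv y x - (Q x)%:C * y x).
  have h : ae_on a b (fun x => p x * w x = 1 /\ p x * r x = Q x).
    apply: ae_imply2 hp0 (ae_imply2 (fun x => @conj _ _) pw pr) => x px [hw hr] xab.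
    by rewrite -hw // -hr //; split; field; exact: px.
  apply: ae_imply2 h (ae_imply2 (fun x => @conj _ _) dy1 dy2) => x h [h1 h2] xab.
  have [hw hr] := h xab.
  rewrite (cderiv_is_derive (h1 xab) (h2 xab)).
  apply: complex_ext; rewrite /= !mul0r ?subr0 ?addr0 ?add0r.
  - by rewrite mulrDr !mulrA hw hr mul1r addrK.
  - by rewrite mulrDr !mulrA hw hr mul1r addrK.
have [aq qE] := ac_versionE az zE.
split; last exact: qE.
split.
- exact: (in_L2_bmeas ny1 ny2 (aeW _ (fun x _ => erefl _))).
- exact: abs_continuous_complex.
- exact: aq.
- apply: (in_L2_bmeas nF1 nF2).
  apply: ae_imply2 (ae_imply2 (fun x => @conj _ _) pr ps)
    (ae_imply2 (fun x => @conj _ _) dz1 dz2)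
    => x [hr hs] [h1 h2] xab.
  rewrite /qderiv2 -/y.
  (* Equality on [[a, b]] holds in a full neighbourhood of each interior point, so the derivatives
     coincide. *)
  have -> : cderiv (qderiv1 a b p Q y) x = cderiv z x.
    apply: near_eq_cderiv; near=> t; apply: qE; apply: subset_itv_oo_cc.
    by near: t; exact: near_in_itvoo.
  rewrite (cderiv_is_derive (h1 xab) (h2 xab)) hr // hs //.
  rewrite [qderiv1 _ _ _ _ _ _](qE x); last exact: subset_itv_oo_cc xab.
  by apply: complex_ext; rewrite /= ?mul0r; ring.
Unshelve. all: by end_near. Qed.

End Coefficients.
End Interval.
End ComplexDomain.

(** * Boundary conditions *)

Section BoundaryConditions.
Context {R : realType}.

(** Collecting the terms with [K] turns the condition into [K (u + i v) = u - i v], read row by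
    row. *)
Lemma boundary_rows (K : 'M[R[i]]_2) (u v : 'cV[R[i]]_2) :
  (K - 1%:M) *m u + 'i%C *: ((K + 1%:M) *m v) = 0 <->
  forall i, K i 0 * (u 0 0 + 'i%C * v 0 0) + K i 1 * (u 1 0 + 'i%C * v 1 0)
            = u i 0 - 'i%C * v i 0.
Proof.
have l1 : lift ord0 ord0 = 1 :> 'I_2 by apply: val_inj.
have rowE i : ((K - 1%:M) *m u + 'i%C *: ((K + 1%:M) *m v)) i 0 =
    K i 0 * (u 0 0 + 'i%C * v 0 0) + K i 1 * (u 1 0 + 'i%C * v 1 0) - (u i 0 - 'i%C * v i 0).
  rewrite !mxE !big_ord_recl !big_ord0 !mxE l1.
  have [->|->] : i = 0 \/ i = 1.
    by case: i => [[|[|//]] ilt]; [left|right]; apply: val_inj.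
  - by rewrite /=; ring.
  - by rewrite /=; ring.
split=> [h i|h]; first by apply/eqP; rewrite -subr_eq0 -rowE h mxE.
by apply/matrixP => i j; rewrite ord1 rowE h subrr mxE.
Qed.

Lemma dom_LK_rows (a b : R) (p Q : R -> R) (K : 'M[R[i]]_2) (y : R -> R[i]) :
  let q := qderiv1 a b p Q y in
  dom_LK a b p Q K y <-> [/\ dom_Lmax a b p Q y,
    K 0 0 * (q a + 'i%C * y a) + K 0 1 * (- q b + 'i%C * y b) = q a - 'i%C * y a &
    K 1 0 * (q a + 'i%C * y a) + K 1 1 * (- q b + 'i%C * y b) = - q b - 'i%C * y b].
Proof.
move=> q; split.
- case=> dy /boundary_rows h; split=> //.
    by have := h 0; rewrite !mxE.
  by have := h 1; rewrite !mxE.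
- case=> dy h0 h1; split=> //; apply/boundary_rows => i; rewrite !mxE /=.
  have [->|->] : i = 0 \/ i = 1.
    by case: i => [[|[|//]] ilt]; [left|right]; apply: val_inj.
  - exact: h0.
  - exact: h1.
Qed.

(** The second row has norm 1, so [K 1 1] is unimodular; orthogonality of the rows then kills
    [K 0 1], and the norm of the first row gives the rest. *)
Lemma unitary_triangular (K : 'M[R[i]]_2) : K \is unitarymx -> K 1 0 = 0 ->
  [/\ `|K 0 0| = 1, `|K 1 1| = 1 & K 0 1 = 0].
Proof.
move=> /unitarymxP KK K10.
have l1 : lift ord0 ord0 = 1 :> 'I_2 by apply: val_inj.
have E i j : K i 0 * (K j 0)^* + K i 1 * (K j 1)^* = (i == j)%:R.
  by have /matrixP /(_ i j) := KK; rewrite !mxE !big_ord_recl big_ord0 !mxE l1 addr0.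
have norm1 (x : R[i]) : x * x^* = 1 -> `|x| = 1.
  move=> xx; apply/eqP; rewrite -(@eqrXn2 _ 2) ?ler01 ?normr_ge0 //.
  by rewrite normCK xx expr1n.
have n11 : `|K 1 1| = 1 by apply: norm1; have := E 1 1; rewrite K10 mul0r add0r.
have k11 : K 1 1 != 0 by rewrite -normr_eq0 n11 oner_eq0.
have k01 : K 0 1 = 0.
  have := E 0 1; rewrite K10 conjC0 mulr0 add0r => /eqP.
  by rewrite mulf_eq0 conjC_eq0 (negbTE k11) orbF => /eqP.
by split=> //; apply: norm1; have := E 0 0; rewrite k01 mul0r addr0.
Qed.

Section Existence.
Variables (a b : R) (p Q w r s : R -> R).
Hypothesis ab : a < b.
Hypotheses (hp0 : ae_on a b (fun x => p x != 0))
  (pw : ae_on a b (fun x => 1 / p x = w x))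
  (pr : ae_on a b (fun x => Q x / p x = r x))
  (ps : ae_on a b (fun x => Q x ^+ 2 / p x = s x)).
Hypotheses (hw : lebesgue_measure.-integrable `]a, b[ (fun x => (w x)%:E))
  (hr : lebesgue_measure.-integrable `]a, b[ (fun x => (r x)%:E))
  (hs : lebesgue_measure.-integrable `]a, b[ (fun x => (s x)%:E)).

(** The coefficients are real, so real and imaginary parts are built separately: [g] from left
    pairs, [h] from right pairs, and [y = g + h]. *)
Lemma exists_split_function (a0 a1 b0 b1 : R[i]) : exists y g h : R -> R[i],
  let q := qderiv1 a b p Q in
  [/\ [/\ dom_Lmax a b p Q y, dom_Lmax a b p Q g & dom_Lmax a b p Q h],
      same_germ a b a g y /\ same_germ a b b g (fun=> 0),
      same_germ a b a h (fun=> 0) /\ same_germ a b b h y,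
      [/\ y a = a0, q y a = a1, y b = b0 & q y b = b1] &
      [/\ g a = a0, q g a = a1, g b = 0 & q g b = 0]].
Proof.
have wn0 : ae_on a b (fun x => w x != 0).
  apply: ae_imply2 hp0 pw => x px pwx xab; rewrite -pwx // div1r invr_eq0.
  exact: px.
have aab : a \in `[a, b] by rewrite in_itv /= lexx ltW.
have bab : b \in `[a, b] by rewrite in_itv /= lexx ltW.
have [g1 [k1 [pg1 [g1a k1a] [d1 d1b g1d]]]] :=
  left_pair ab hw hr hs wn0 (complex.Re a0) (complex.Re a1).
have [g2 [k2 [pg2 [g2a k2a] [d2 d2b g2d]]]] :=
  left_pair ab hw hr hs wn0 (complex.Im a0) (complex.Im a1).
have [h1 [l1 [ph1 [h1b l1b] [c1 ac1 h1c]]]] :=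
  right_pair ab hw hr hs wn0 (complex.Re b0) (complex.Re b1).
have [h2 [l2 [ph2 [h2b l2b] [c2 ac2 h2c]]]] :=
  right_pair ab hw hr hs wn0 (complex.Im b0) (complex.Im b1).
have [dy qy] := real_pair_dom ab hp0 pw pr ps (real_pairD pg1 ph1) (real_pairD pg2 ph2).
have [dg qg] := real_pair_dom ab hp0 pw pr ps pg1 pg2.
have [dh qh] := real_pair_dom ab hp0 pw pr ps ph1 ph2.
have [h1a l1a] := h1c a (ltW ac1); have [h2a l2a] := h2c a (ltW ac2).
have [g1b k1b] := g1d b (ltW d1b); have [g2b k2b] := g2d b (ltW d2b).
exists (fun x => (g1 x + h1 x) +i* (g2 x + h2 x)),
  (fun x => g1 x +i* g2 x), (fun x => h1 x +i* h2 x).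
split.
- by split.
- split; rewrite /same_germ near_withinE; near=> x => _.
  + have [-> _] : h1 x = 0 /\ l1 x = 0 by apply: h1c; near: x; exact: lt_le_nbhsl.
    have [-> _] : h2 x = 0 /\ l2 x = 0 by apply: h2c; near: x; exact: lt_le_nbhsl.
    by rewrite !addr0.
  + have [-> _] : g1 x = 0 /\ k1 x = 0 by apply: g1d; near: x; exact: lt_le_nbhsr.
    have [-> _] : g2 x = 0 /\ k2 x = 0 by apply: g2d; near: x; exact: lt_le_nbhsr.
    by [].
- split; rewrite /same_germ near_withinE; near=> x => _.
  + have [-> _] : h1 x = 0 /\ l1 x = 0 by apply: h1c; near: x; exact: lt_le_nbhsl.
    have [-> _] : h2 x = 0 /\ l2 x = 0 by apply: h2c; near: x; exact: lt_le_nbhsl.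
    by [].
  + have [-> _] : g1 x = 0 /\ k1 x = 0 by apply: g1d; near: x; exact: lt_le_nbhsr.
    have [-> _] : g2 x = 0 /\ k2 x = 0 by apply: g2d; near: x; exact: lt_le_nbhsr.
    by rewrite !add0r.
- rewrite (qy a aab) (qy b bab) g1a h1a g2a h2a g1b h1b g2b h2b.
  rewrite k1a l1a k2a l2a k1b l1b k2b l2b !addr0 !add0r.
  by split; apply: complex_ext.
- rewrite (qg a aab) (qg b bab) g1a g2a g1b g2b k1a k2a k1b k2b.
  by split; try apply: complex_ext.
Unshelve. all: by end_near. Qed.

End Existence.
End BoundaryConditions.

(** * Separated conditions and diagonal unitary matrices *)

Unset Implicit Arguments.

Theorem theorem5 (R : realType) (a b : R) (hab : a < b) (p Q : R -> R)
    (hp : lebesgue_measurable_on a b p)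
    (hQ : lebesgue_measurable_on a b Q)
    (hp0 : ae_on a b (fun x => p x != 0))
    (h1p : in_L1 a b (fun x => 1 / p x))
    (hQp : in_L1 a b (fun x => Q x / p x))
    (hQ2p : in_L1 a b (fun x => Q x ^+ 2 / p x))
    (K : 'M[R[i]]_2) (hK : K \is unitarymx) :
  separated_bc a b p Q (dom_LK a b p Q K) <->
  exists Ka Kb : R[i],
    [/\ `|Ka| = 1, `|Kb| = 1 &
        K = diag_mx (\row_(j < 2) if j == 0 then Ka else Kb)].
Proof.
have [w iw pw] := h1p; have [r ir pr] := hQp; have [s irs ps] := hQ2p.
(* The imaginary unit is first generalised to [j] for [ring]; its square is evaluated afterwards. *)
have iNi (x : R[i]) : 'i%C * (- 'i%C * x / 2) = x / 2.
  have e (j t : R[i]) : j * (- j * t / 2) = - (j ^+ 2) * (t / 2) by ring.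
  by rewrite e sqr_i opprK mul1r.
have i_i (x : R[i]) : 'i%C * ('i%C * x / 2) = - (x / 2).
  have e (j t : R[i]) : j * (j * t / 2) = j ^+ 2 * (t / 2) by ring.
  by rewrite e sqr_i mulN1r.
split.
- move=> sep.
  (* These values solve [Gamma1 y + i Gamma2 y = (1, 0)] and
     [Gamma1 y - i Gamma2 y = (K 0 0, K 1 0)], the first column of [K]. *)
  have [y [g [h [[dy dg dh] [gya gb] [ha hyb] [ya qya yb qyb] [ga qga gb0 qgb]]]]] :=
    exists_split_function hab hp0 pw pr ps iw ir irs
      (- 'i%C * (1 - K 0 0) / 2) ((1 + K 0 0) / 2) ('i%C * K 1 0 / 2) (- (K 1 0 / 2)).
  have Dy : dom_LK a b p Q K y.
    by apply/dom_LK_rows; rewrite ya qya yb qyb iNi i_i; split => //; field.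
  (* For [g] the combination at [a] is still 1 while all data at [b] vanish, so the second row
     reduces to [K 1 0 = 0]. *)
  have [/dom_LK_rows [_ _ + ] _] := sep y g h Dy dg dh gya gb ha hyb.
  rewrite ga qga gb0 qgb iNi mulr0 oppr0 addr0 mulr0 addr0 => row1.
  have K10 : K 1 0 = 0 by rewrite -row1; field.
  have [n0 n1 K01] := unitary_triangular hK K10.
  exists (K 0 0), (K 1 1); split=> //.
  apply/matrixP => i j; rewrite !mxE.
  have I2 (k : 'I_2) : k = 0 \/ k = 1.
    by case: k => [[|[|//]] ilt]; [left|right]; apply: val_inj.
  by have [->|->] := I2 i; have [->|->] := I2 j; rewrite /= ?mulr1n ?mulr0n.
- move=> [Ka [Kb [_ _ KE]]] y g h Dy dg dh gya gb ha hyb.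
  have aab : a \in `[a, b] by rewrite in_itv /= lexx ltW.
  have bab : b \in `[a, b] by rewrite in_itv /= lexx ltW.
  (* The zero function lies in the maximal domain with zero quasi-derivative, so a vanishing germ
     can be compared with it. *)
  have z0 : real_pair a b w r s (fun=> 0) (fun=> 0) by exact: real_pair0.
  have [d0 q0] := real_pair_dom hab hp0 pw pr ps z0 z0.
  have /dom_LK_rows [dy row0 row1] := Dy.
  have aq (f : R -> R[i]) : dom_Lmax a b p Q f -> abs_continuous a b (qderiv1 a b p Q f).
    by case.
  have [ga qga] := germ_boundary_values hab (aq _ dy) (aq _ dg) aab gya.
  have [gb0 qgb] := germ_boundary_values hab (aq _ d0) (aq _ dg) bab gb.
  have [ha0 qha] := germ_boundary_values hab (aq _ d0) (aq _ dh) aab ha.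
  have [hb qhb] := germ_boundary_values hab (aq _ dy) (aq _ dh) bab hyb.
  have K01 : K 0 1 = 0 by rewrite KE !mxE.
  have K10 : K 1 0 = 0 by rewrite KE !mxE.
  rewrite (q0 b bab) in qgb; rewrite (q0 a aab) in qha.
  move: row0 row1; rewrite K01 K10 !mul0r !addr0 !add0r => row0 row1.
  (* For diagonal [K] each row involves one end-point: it is inherited from [y] there or reads 0 =
     0. *)
  split; apply/dom_LK_rows; split=> //;
    rewrite ?K01 ?K10 ?ga ?qga ?gb0 ?qgb ?ha0 ?qha ?hb ?qhb.
  + by rewrite mul0r addr0.
  + by rewrite (_ : 0 +i* 0 = 0) // oppr0 !mulr0 addr0 subrr mulr0 mul0r addr0.
  + by rewrite (_ : 0 +i* 0 = 0) // !mulr0 addr0 subrr mulr0 mul0r addr0.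
  + by rewrite mul0r add0r.
Qed.
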